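(* Let $A_0,\dots,A_M\in\mathbb{R}^{d\times d}$ be pairwise commuting matrices, let $D\in\mathbb{R}^{d\times d}$ be symmetric, and assume that each $A_m$, $m=0,\dots,M$, is skew-symmetric and commutes with $D$. Let $\mathcal{I}(x)=x^\top D x$ for $x\in\mathbb{R}^d$. Then, for every $t\ge t_n$, $$\mathcal{I}(v)=\mathcal{I}\bigl(e^{L^n(t)}v\bigr)\qquad\text{for all } v\in\mathbb{R}^d .$$
   Context: $W_0(t)=t$ and $W_1,\dots,W_M$ are independent one-dimensional Wiener processes. For a fixed time $t_n$, $L^n(t)=\sum_{m=0}^MA_m\,(W_m(t)-W_m(t_n))$. *)

(* Defs.v *)
From mathcomp Require Export all_boot all_order all_algebra.
From mathcomp Require Export all_classical all_reals all_analysis.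

Set Implicit Arguments.
Unset Strict Implicit.
Unset Printing Implicit Defensive.
Import Order.TTheory GRing.Theory Num.Theory.
Import numFieldNormedType.Exports.
Local Open Scope classical_set_scope.
Local Open Scope ring_scope.

(* The limit is taken for the entrywise (max-norm) topology on matrices. *)
Definition expmx_coeff (R : realType) (d : nat) (A : 'M[R]_d) :
  nat -> 'M[R]_d := fun k => k`!%:R^-1 *: A ^+ k.

Definition expmx (R : realType) (d : nat) (A : 'M[R]_d) : 'M[R]_d :=
  limn (series (expmx_coeff A)).

Lemma normr_mulmx_le (R : realType) (d : nat) (A B : 'M[R]_d) :
  `|A *m B| <= d%:R * (`|A| * `|B|).
Proof.
have entry (M : 'M[R]_d) i j : `|M i j| <= `|M|.
  rewrite [leRHS]mx_normrE.
  exact: (@le_bigmax _ _ _ 0 (fun p : 'I_d * 'I_d => `|M p.1 p.2|) (i, j)).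
rewrite [leLHS]mx_normrE; apply: bigmax_le => [|[i j] _ /=].
  by rewrite !mulr_ge0.
rewrite mxE (le_trans (ler_norm_sum _ _ _))//.
rewrite mulr_natl -[X in _ *+ X]card_ord -sumr_const.
by apply: ler_sum => k _; rewrite normrM ler_pM.
Qed.

(* The series converges for every matrix, so that [expmx] is never a default
   value of [limn]. *)
Lemma is_cvg_series_expmx_coeff (R : realType) (d : nat) (A : 'M[R]_d) :
  cvgn (series (expmx_coeff A)).
Proof.
suff : cvgn [normed series (expmx_coeff A)].
  move=> /cauchy_cvgP/cauchy_seriesP ncvg.
  apply/cauchy_cvgP/cauchy_seriesP => e /ncvg.
  apply: filterS => n /=; rewrite ger0_norm ?sumr_ge0//.
  by apply: le_lt_trans; apply: ler_norm_sum.
pose C := `|1 : 'M[R]_d|; have C0 : 0 <= C by exact: normr_ge0.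
apply: (@series_le_cvg _ _ (fun k => C * exp_coeff (d%:R * `|A|) k)).
- by move=> k /=.
- move=> k /=; apply: mulr_ge0 => //; apply: exp_coeff_ge0.
  by rewrite mulr_ge0.
- move=> k /=; rewrite /expmx_coeff /exp_coeff normrZ ger0_norm ?invr_ge0//.
  rewrite mulrA [leRHS]mulrC ler_wpM2l ?invr_ge0//.
  elim: k => [|k IH]; first by rewrite !expr0 mulr1.
  rewrite exprS (le_trans (normr_mulmx_le _ _))// exprS mulrA [leRHS]mulrCA.
  by rewrite ler_wpM2l// mulr_ge0.
- exact: (is_cvg_seriesZ (k := C) (is_cvg_series_exp_coeff (d%:R * `|A|))).
Qed.

Definition quadratic_form (R : realType) (d : nat) (D : 'M[R]_d)
    (x : 'cV[R]_d) : R := (x^T *m D *m x) 0 0.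

(* Meant for classes of events containing [setT] (in particular sigma-algebras),
   for which the product rule over the whole family contains the product rule
   over each of its subfamilies. *)
Definition independent_classes (dT : measure_display) (T : measurableType dT)
    (R : realType) (P : probability T R) (n : nat)
    (F : 'I_n -> set (set T)) : Prop :=
  forall E : 'I_n -> set T, (forall i, F i (E i)) ->
    P (\bigcap_i E i) = (\prod_(i < n) P (E i))%E.

Definition independent_RVs (dT : measure_display) (T : measurableType dT)
    (R : realType) (P : probability T R) (n : nat)
    (X : 'I_n -> T -> R) : Prop :=
  independent_classes P
    (fun i => preimage_set_system setT (X i) measurable).

(* Processes are families of functions indexed by R, of which only the values
   at nonnegative times matter. *)
Definition process_sigma_algebra (dT : measure_display)
    (T : measurableType dT) (R : realType) (X : R -> T -> R) : set (set T) :=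
  <<s \bigcup_(t in `[0, +oo[)
        preimage_set_system setT (X t) measurable >>.

Definition independent_processes (dT : measure_display)
    (T : measurableType dT) (R : realType) (P : probability T R) (n : nat)
    (X : 'I_n -> R -> T -> R) : Prop :=
  independent_classes P (fun i => process_sigma_algebra (X i)).

(* The second parameter of [normal_prob] is the standard deviation. *)
Record wiener_process (dT : measure_display) (T : measurableType dT)
    (R : realType) (P : probability T R) (W : R -> T -> R) : Prop := {
  wiener_measurable : forall t : R, 0 <= t -> measurable_fun setT (W t) ;
  wiener_start : {ae P, forall w, W 0 w = 0} ;
  wiener_independent_increments :
    forall (n : nat) (t : nat -> R),
      0 <= t 0%N -> (forall i, t i <= t i.+1) ->
      independent_RVs P (fun (i : 'I_n) w => W (t i.+1) w - W (t i) w) ;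
  wiener_gaussian_increments :
    forall s t : R, 0 <= s -> s < t ->
      forall B : set R, measurable B ->
        P [set w | B (W t w - W s w)] = normal_prob 0 (Num.sqrt (t - s)) B ;
  wiener_continuous_paths :
    {ae P, forall w, {within `[0, +oo[, continuous (fun t => W t w)}} }.

(* Index 0 is the deterministic time component, index [m.+1] is the [m]-th of
   the M Wiener processes. *)
Record driving_process (dT : measure_display) (T : measurableType dT)
    (R : realType) (P : probability T R) (M : nat)
    (W : 'I_M.+1 -> R -> T -> R) : Prop := {
  driving_time : forall (t : R) (w : T), 0 <= t -> W ord0 t w = t ;
  driving_wiener : forall m : 'I_M, wiener_process P (W (lift ord0 m)) ;
  driving_independent :
    independent_processes P (fun m : 'I_M => W (lift ord0 m)) }.

Definition increment_sum (T : Type) (R : realType) (d M : nat)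
    (A : 'I_M.+1 -> 'M[R]_d) (W : 'I_M.+1 -> R -> T -> R)
    (tn t : R) (w : T) : 'M[R]_d :=
  \sum_(m < M.+1) (W m t w - W m tn w) *: A m.

(* Main.v *)
Require Import Defs.
Import Order.TTheory GRing.Theory Num.Theory.
Set Implicit Arguments.
Unset Strict Implicit.
Unset Printing Implicit Defensive.
Import numFieldNormedType.Exports.
Local Open Scope ring_scope.

(** Write L for the increment [increment_sum A W tn t w].  Whatever the path is,
    L is a linear combination of the matrices [A m], hence a skew-symmetric
    matrix that commutes with D.  The exponential E of such a matrix is
    orthogonal ([expmx_skew_orthogonal]), since its transpose is the exponential
    of -L, and it commutes with D because every partial sum of the series does
    ([comm_mx_expmx]).  Hence E^T D E = E^T E D = D, which is the claim
    for that path ([quadratic_form_expmx]).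

    The analytic content is the equality exp(-L) exp(L) = 1, a case of
    exp(A + B) = exp(A) exp(B) for commuting A and B ([expmxD]).  The product of
    the n-th partial sums of exp(A) and exp(B) is the n-th partial sum of
    exp(A + B), plus the terms A^j B^i / (j! i!) with i, j < n <= i + j.  In
    norm, these are at most a constant times the corresponding terms for the
    real numbers a = d |A| and b = d |B|.  The same decomposition, read for real
    numbers, shows that the latter add up to a sequence converging to
    e^a e^b - e^(a + b), which vanishes by the functional equation of the real
    exponential. *)

(** * Skew-symmetric matrices *)

Lemma trmx_skew (K : fieldType) (d : nat) (A : 'M[K]_d) :
  A \is skewmx -> A^T = - A.
Proof. by move=> /trmx_sesqui; rewrite expr1 scaleN1r map_mx_id. Qed.

Lemma skewmx_sum (K : fieldType) (d : nat) (I : finType) (c : I -> K)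
    (A : I -> 'M[K]_d) :
  (forall i, A i \is skewmx) -> \sum_i c i *: A i \is skewmx.
Proof.
move=> skewA; apply/is_hermitianmxP; rewrite expr1 scaleN1r map_mx_id//.
rewrite raddf_sum -sumrN; apply: eq_bigr => i _.
by rewrite /= linearZ/= trmx_skew// scalerN opprK.
Qed.

(** * Entrywise convergence of matrices *)

Section matrix_convergence.
Local Open Scope classical_set_scope.
Context {K : numFieldType} {S : Type} {F : set_system S} {FF : Filter F}.

Lemma cvg_mx (m n : nat) (X : S -> 'M[K]_(m, n)) (L : 'M[K]_(m, n)) :
  (forall i j, X x i j @[x --> F] --> L i j) -> X x @[x --> F] --> L.
Proof.
move=> XL A [B BL BA].
have FB : F [set x | forall i j, B i j (X x i j)].
  apply: filter_forall => i; apply: filter_forall => j.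
  exact: XL (BL i j).
by apply: filterS FB => x; apply: BA.
Qed.

Lemma cvg_mulmx (m n p : nat) (X : S -> 'M[K]_(m, n)) (Y : S -> 'M[K]_(n, p))
    (L : 'M[K]_(m, n)) (M : 'M[K]_(n, p)) :
  X x @[x --> F] --> L -> Y x @[x --> F] --> M ->
  X x *m Y x @[x --> F] --> L *m M.
Proof.
move=> XL YM; apply: cvg_mx => i j; rewrite mxE.
under eq_fun do rewrite mxE.
apply: cvg_big => [|k _]; first exact: add_continuous.
have XLk := cvg_comp _ _ XL (@coord_continuous K m n i k L).
have YMk := cvg_comp _ _ YM (@coord_continuous K n p k j M).
exact: cvgM XLk YMk.
Qed.

Lemma cvg_trmx (m n : nat) (X : S -> 'M[K]_(m, n)) (L : 'M[K]_(m, n)) :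
  X x @[x --> F] --> L -> (X x)^T @[x --> F] --> L^T.
Proof.
move=> XL; apply: cvg_mx => i j; rewrite mxE.
under eq_fun do rewrite mxE.
exact: (cvg_comp _ _ XL (@coord_continuous K m n j i L)).
Qed.

End matrix_convergence.

(** * Exponential series of a sum *)

(** The square i, j < n is cut along the antidiagonal i + j = n.  The identity
    is purely algebraic, so that it serves both for matrices and for the real
    numbers that dominate them. *)
Lemma series_cauchy_product (R : pzRingType) (p q : nat -> R) (n : nat) :
  series p n * series q n =
    series (fun k => \sum_(i < k.+1) p (k - i)%N * q i) n
    + \sum_(i < n) \sum_(n - i <= j < n) p j * q i.
Proof.
have triangle : series (fun k => \sum_(i < k.+1) p (k - i)%N * q i) n =
    \sum_(i < n) \sum_(0 <= j < n - i) p j * q i.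
  elim: n => [|n IHn]; first by rewrite seriesEnat /= !(big_geq, big_ord0).
  rewrite seriesEnat /= big_nat_recr//= -[X in X + _]/(series _ n) IHn.
  under [RHS]eq_bigr => i _.
    rewrite subSn; last by rewrite -ltnS.
    rewrite big_nat_recr//=.
    over.
  rewrite big_split/=; congr (_ + _).
  by rewrite big_ord_recr/= subnn big_geq ?addr0.
rewrite triangle -big_split/= !seriesEnat/= big_distrr/= big_mkord.
apply: eq_bigr => i _; rewrite big_distrl/=.
by rewrite (@big_cat_nat _ _ _ (n - i)) // leq_subr.
Qed.

(** The weights that turn the binomial formula into a convolution of exponential
    coefficients. *)
Lemma invf_fact_bin (K : numFieldType) (k i : nat) : (i <= k)%N ->
  k`!%:R^-1 * 'C(k, i)%:R = (k - i)`!%:R^-1 * i`!%:R^-1 :> K.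
Proof.
move=> ik; rewrite -(bin_fact ik) !natrM.
have fact_neq0 m : m`!%:R != 0 :> K by rewrite pnatr_eq0 -lt0n fact_gt0.
have C_neq0 : 'C(k, i)%:R != 0 :> K by rewrite pnatr_eq0 -lt0n bin_gt0.
by rewrite !invfM mulrAC mulVf// mul1r mulrC.
Qed.

Lemma exp_coeffD (R : realType) (a b : R) (k : nat) :
  exp_coeff (a + b) k =
  \sum_(i < k.+1) exp_coeff a (k - i)%N * exp_coeff b i.
Proof.
rewrite /exp_coeff/= exprDn mulrC big_distrr/=.
apply: eq_bigr => i _; rewrite -[X in _ * X]mulr_natl [LHS]mulrA.
rewrite invf_fact_bin; last by rewrite -ltnS.
by rewrite mulrC mulrACA.
Qed.

Lemma expmx_coeffD (R : realType) (d : nat) (A B : 'M[R]_d) (k : nat) :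
  comm_mx A B ->
  expmx_coeff (A + B) k =
  \sum_(i < k.+1) expmx_coeff A (k - i)%N *m expmx_coeff B i.
Proof.
rewrite comm_mxE => AB; rewrite /expmx_coeff (exprDn_comm k AB) scaler_sumr.
apply: eq_bigr => i _; rewrite -[X in _ *: X]scaler_nat scalerA.
rewrite invf_fact_bin; last by rewrite -ltnS.
by rewrite -scalemxAl -scalemxAr scalerA.
Qed.

(** * The matrix exponential *)

Section matrix_exponential.
Context {R : realType} {d : nat}.
Implicit Types A B : 'M[R]_d.

Lemma cvg_expmx A : (series (expmx_coeff A) n @[n --> \oo] --> expmx A)%classic.
Proof. exact: is_cvg_series_expmx_coeff. Qed.

(** The entrywise norm is submultiplicative only up to the factor d, which is
    absorbed in the argument of the real exponential. *)
Lemma normr_expmx_coeff_le A (k : nat) :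
  `|expmx_coeff A k| <= `|1 : 'M[R]_d| * exp_coeff (d%:R * `|A|) k.
Proof.
rewrite /expmx_coeff /exp_coeff/= normrZ ger0_norm ?invr_ge0//.
rewrite mulrA [leRHS]mulrC ler_wpM2l ?invr_ge0//.
elim: k => [|k IHk]; first by rewrite !expr0 mulr1.
rewrite exprS (le_trans (normr_mulmx_le _ _))// exprS mulrA [leRHS]mulrCA.
by rewrite ler_wpM2l// mulr_ge0.
Qed.

(** The remainder of the Cauchy product of the two matrix series is dominated by
    the remainder of the Cauchy product of two real exponential series, which
    tends to 0 because [expR] is already known to satisfy [expRD]. *)
Lemma expmxD A B : comm_mx A B -> expmx (A + B) = expmx A *m expmx B.
Proof.
move=> AB; pose a := d%:R * `|A|; pose b := d%:R * `|B|.
pose tail n := \sum_(i < n) \sum_(n - i <= j < n)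
  expmx_coeff A j *m expmx_coeff B i.
have tailE n : series (expmx_coeff A) n *m series (expmx_coeff B) n =
    series (expmx_coeff (A + B)) n + tail n.
  rewrite -[LHS]/(series _ n * series _ n) series_cauchy_product.
  congr (_ + _); apply: eq_bigr => k _; exact/esym/expmx_coeffD.
pose rtail n := \sum_(i < n) \sum_(n - i <= j < n)
  exp_coeff a j * exp_coeff b i.
have rtailE n : rtail n = series (exp_coeff a) n * series (exp_coeff b) n
    - series (exp_coeff (a + b)) n.
  rewrite series_cauchy_product addrC.
  under [X in series X]funext do rewrite exp_coeffD.
  by rewrite addKr.
have rtail0 : (rtail n @[n --> \oo] --> (0 : R))%classic.
  rewrite (funext rtailE) -(subrr (expR a * expR b)) -{2}expRD.
  by apply: cvgB; [apply: cvgM|]; exact: is_cvg_series_exp_coeff.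
pose C := d%:R * (`|1 : 'M[R]_d| * `|1 : 'M[R]_d|).
have tail_le n : `|tail n| <= C * rtail n.
  rewrite (le_trans (ler_norm_sum _ _ _))// big_distrr/=.
  apply: ler_sum => i _.
  rewrite (le_trans (ler_norm_sum _ _ _))// big_distrr/=.
  apply: ler_sum => j _.
  rewrite (le_trans (normr_mulmx_le _ _))// -mulrA ler_wpM2l// mulrACA.
  by rewrite ler_pM// normr_expmx_coeff_le.
have tail0 : (tail n @[n --> \oo] --> (0 : 'M[R]_d))%classic.
  apply/norm_cvg0P.
  apply: (@squeeze_cvgr _ _ _ _ (fun=> 0) (fun n => C * rtail n)).
  - by near=> n; rewrite normr_ge0/=.
  - exact: cvg_cst.
  - by rewrite -(mulr0 C); apply: cvgM => //; exact: cvg_cst.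
have lim1 := cvg_mulmx (@cvg_expmx A) (@cvg_expmx B).
rewrite (funext tailE) in lim1.
have lim2 := cvgD (@cvg_expmx (A + B)) tail0.
rewrite -[LHS]addr0; exact: (norm_cvg_unique (lim2 _) (lim1 _)).
Unshelve. all: by end_near. Qed.

Lemma expmx0 : expmx (0 : 'M[R]_d) = 1.
Proof.
apply: (cvg_lim (@norm_hausdorff _ _)); apply: cvg_near_cst; near=> n.
have n0 : (0 < n)%N by near: n; exact: nbhs_infty_gt.
rewrite seriesEnat/= big_ltn// big_nat big1 ?addr0.
  by rewrite /expmx_coeff invr1 expr0 scale1r.
by move=> k /andP[k0 _]; rewrite /expmx_coeff expr0n gtn_eqF// scaler0.
Unshelve. all: by end_near. Qed.

Lemma trmx_expr A (k : nat) : (A ^+ k)^T = A^T ^+ k.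
Proof.
elim: k => [|k IHk]; first by rewrite !expr0 trmx1.
by rewrite exprSr exprS -IHk trmx_mul.
Qed.

Lemma trmx_expmx A : (expmx A)^T = expmx A^T.
Proof.
have lim := cvg_trmx (@cvg_expmx A); apply: norm_cvg_unique (lim _) _.
rewrite (_ : (fun n => _) = series (expmx_coeff A^T)); first exact: cvg_expmx.
apply/funext => n; rewrite !seriesEnat/= raddf_sum.
by apply: eq_bigr => k _; rewrite /= linearZ/= trmx_expr.
Qed.

Lemma comm_mx_expmx A B : comm_mx A B -> comm_mx A (expmx B).
Proof.
move=> AB; rewrite /comm_mx.
have liml : (A *m series (expmx_coeff B) n @[n --> \oo] -->
    A *m expmx B)%classic.
  by apply: cvg_mulmx; [exact: cvg_cst | exact: cvg_expmx].
have limr : (series (expmx_coeff B) n *m A @[n --> \oo] -->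
    expmx B *m A)%classic.
  by apply: cvg_mulmx; [exact: cvg_expmx | exact: cvg_cst].
apply: (norm_cvg_unique liml).
rewrite (_ : (fun n => _) = (fun n => series (expmx_coeff B) n *m A))//.
apply/funext => n; apply: comm_mx_sum => k _.
rewrite /comm_mx -scalemxAr -scalemxAl; congr (_ *: _).
by rewrite comm_mxE in AB; exact: commrX.
Qed.

(** * Quadratic forms preserved by exponentials of skew-symmetric matrices *)

Lemma expmx_skew_orthogonal A : A \is skewmx -> (expmx A)^T *m expmx A = 1%:M.
Proof.
move=> skewA; rewrite trmx_expmx trmx_skew// -expmxD ?addNr ?expmx0// comm_mxE.
exact/commr_sym/commrN.
Qed.

(** With E the exponential of A, moving D to the right of E turns E^T D E into
    E^T E D = D. *)
Lemma quadratic_form_expmx (D A : 'M[R]_d) (v : 'cV[R]_d) :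
  A \is skewmx -> comm_mx A D ->
  quadratic_form D (expmx A *m v) = quadratic_form D v.
Proof.
move=> skewA AD; have /comm_mx_expmx DE := comm_mx_sym AD.
rewrite /quadratic_form trmx_mul !mulmxA -[_ *m D *m _]mulmxA DE.
by rewrite mulmxA -[_ *m _^T *m _]mulmxA expmx_skew_orthogonal// mulmx1.
Qed.

End matrix_exponential.

Theorem lemma2 (R : realType) (dT : measure_display) (T : measurableType dT)
    (P : probability T R) (d M : nat)
    (W : 'I_M.+1 -> R -> T -> R) (A : 'I_M.+1 -> 'M[R]_d) (D : 'M[R]_d)
    (tn : R)
    (hW : driving_process P W)
    (hA : forall l m : 'I_M.+1, comm_mx (A l) (A m))
    (hD : D \is symmetricmx)
    (hskew : forall m : 'I_M.+1, A m \is skewmx)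
    (hAD : forall m : 'I_M.+1, comm_mx (A m) D)
    (htn : 0 <= tn) :
  forall t : R, tn <= t ->
  forall (w : T) (v : 'cV[R]_d),
    quadratic_form D v =
    quadratic_form D (expmx (increment_sum A W tn t w) *m v).
Proof.
move=> t _ w v; rewrite quadratic_form_expmx//.
  exact: skewmx_sum.
apply/comm_mx_sym/comm_mx_sum => m _.
rewrite /comm_mx -scalemxAr -scalemxAl; congr (_ *: _).
exact/esym/hAD.
Qed.
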